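(* Let $\Phi$ be a homogeneous Poisson point process on $\mathbb{R}^2$ with intensity $\lambda>0$, let $\boldsymbol{x}_{\rm s},\boldsymbol{x}_{\rm d}\in\mathbb{R}^2$ be at distance $2d$ with $d>0$, and let $\widetilde{\mathsf{SNR}}_1,\widetilde{\mathsf{SNR}}_2>0$. Let $$\Gamma_{\rm opt,diff}=\min_{\boldsymbol{X}\in\Phi}\ \max\left\{\widetilde{\mathsf{SNR}}_1\|\boldsymbol{x}_{\rm s}-\boldsymbol{X}\|,\ \widetilde{\mathsf{SNR}}_2\|\boldsymbol{X}-\boldsymbol{x}_{\rm d}\|\right\},$$ and write $r_1=\gamma/\widetilde{\mathsf{SNR}}_1$ and $r_2=\gamma/\widetilde{\mathsf{SNR}}_2$. Then the cumulative distribution function of $\Gamma_{\rm opt,diff}$ is given by $$F_{\Gamma_{\rm opt,diff}}(\gamma)=0\quad\text{if }\gamma<2d\,\frac{\widetilde{\mathsf{SNR}}_1\widetilde{\mathsf{SNR}}_2}{\widetilde{\mathsf{SNR}}_1+\widetilde{\mathsf{SNR}}_2},$$ and, if $\gamma\ge 2d\,\frac{\widetilde{\mathsf{SNR}}_1\widetilde{\mathsf{SNR}}_2}{\widetilde{\mathsf{SNR}}_1+\widetilde{\mathsf{SNR}}_2}$, $$F_{\Gamma_{\rm opt,diff}}(\gamma)=1-\exp\left(-\lambda r_1^2\sec^{-1}\left(\frac{4d\,r_1}{r_1^2-r_2^2+4d^2}\right)-\lambda r_2^2\sec^{-1}\left(\frac{4d\,r_2}{r_2^2-r_1^2+4d^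2}\right)+\frac{\lambda}{2}\sqrt{(r_1+r_2-2d)(r_1-r_2+2d)(-r_1+r_2+2d)(r_1+r_2+2d)}\right).$$
   Context: $\|\cdot\|$ is the Euclidean norm, and $\sec^{-1}$ is the inverse secant, $\sec^{-1}(u)=\arccos(1/u)$. In the source model, $\mathsf{SNR}_1$ and $\mathsf{SNR}_2$ are the signal-to-noise ratios at the relays and at the destination, the path-loss function is $G(x)=x^{-\alpha}$, and $\widetilde{\mathsf{SNR}}_i=\mathsf{SNR}_i^{-1/\alpha}$ for $i=1,2$; $\boldsymbol{x}_{\rm s},\boldsymbol{x}_{\rm d}$ are the source and destination locations and $\Phi$ is the set of relay locations.
   Formalization: When |r_1-r_2|>2d the printed formula is undefined; there sec^{-1}(u) with 0<|u|<1 is read as 0 (u>0) or π (u<0), and the square root of a negative number as 0; sec^{-1} of a quotient with zero denominator is π/2. *)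

(* Defs.v *)
From HB Require Import structures.
From mathcomp Require Import all_boot all_order all_algebra.
From mathcomp Require Import all_classical all_reals all_analysis.
From mathcomp Require Import finmap measurable_realfun.
Set Implicit Arguments.
Unset Strict Implicit.
Unset Printing Implicit Defensive.
Import Order.TTheory GRing.Theory Num.Theory.
Import numFieldNormedType.Exports.
Local Open Scope classical_set_scope.
Local Open Scope ring_scope.

(* The norm of the library on R * R is the sup norm. *)
Definition eucl_dist (R : realType) (p q : R * R) : R :=
  Num.sqrt ((p.1 - q.1) ^+ 2 + (p.2 - q.2) ^+ 2).

(* sec^-1 u = arccos (1 / u) for 1 <= `|u|. Since 0^-1 = 0, asec 0 = pi / 2 is
   the common value of sec^-1 at +oo and -oo, which is what a quotient with a
   vanishing denominator stands for. For 0 < `|u| < 1 the inverse secant is not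
   real; asec u is then the real part of its principal value, 0 if u > 0 and pi
   if u < 0 (the library's acos is unspecified outside [-1, 1]). *)
Definition asec (R : realType) (u : R) : R :=
  acos (Num.max (-1) (Num.min 1 u^-1)).

Definition lebesgue2 (R : realType) : set (R * R) -> \bar R :=
  (@lebesgue_measure R \x @lebesgue_measure R)%E.

Definition bounded_borel (R : realType) (B : set (R * R)) : Prop :=
  measurable B /\ bounded_set B.

Definition npoints (R : realType) T (Phi : T -> set (R * R)) (B : set (R * R))
    (w : T) : \bar R :=
  counting (Phi w `&` B).

(* A simple point process, given as a random locally finite set. *)
Definition point_process (R : realType) (disp : measure_display)
    (T : measurableType disp) (Phi : T -> set (R * R)) : Prop :=
  (forall w B, bounded_set B -> finite_set (Phi w `&` B)) /\
  (forall B, bounded_borel B -> measurable_fun setT (npoints Phi B)).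

(* The Poisson mass function is spelled out because the library's poisson_pmf
   takes the value 1 everywhere at rate 0, i.e. on Lebesgue-null sets B. *)
Definition homogeneous_poisson (R : realType) (disp : measure_display)
    (T : measurableType disp) (P : probability T R) (lambda : R)
    (Phi : T -> set (R * R)) : Prop :=
  [/\ point_process Phi,
      forall B (n : nat), bounded_borel B ->
        let m := lambda * fine (lebesgue2 B) in
        P [set w | npoints Phi B w = n%:R%:E] =
          (m ^+ n / n`!%:R * expR (- m))%:E
    & forall k (B : 'I_k -> set (R * R)) (n : 'I_k -> nat),
        (forall i, bounded_borel (B i)) -> trivIset setT B ->
        P (\bigcap_i [set w | npoints Phi (B i) w = (n i)%:R%:E]) =
          (\prod_(i < k) P [set w | npoints Phi (B i) w = (n i)%:R%:E])%E].

Definition relay_cost (R : realType) (s1 s2 : R) (xs xd X : R * R) : R :=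
  Num.max (s1 * eucl_dist xs X) (s2 * eucl_dist X xd).

(* The minimum is attained as soon as Phi w is nonempty, see
   Gamma_opt_diff_attained; if Phi w is empty the value is +oo. *)
Definition Gamma_opt_diff (R : realType) T (s1 s2 : R) (xs xd : R * R)
    (Phi : T -> set (R * R)) (w : T) : \bar R :=
  ereal_inf [set (relay_cost s1 s2 xs xd X)%:E | X in Phi w].

Definition cdfe (R : realType) (disp : measure_display)
    (T : measurableType disp) (P : probability T R) (X : T -> \bar R) (r : R)
    : \bar R :=
  P [set w | (X w <= r%:E)%E].

Section Gamma_opt_diff_theory.
Context (R : realType) (disp : measure_display) (T : measurableType disp).
Variables (Phi : T -> set (R * R)) (s1 s2 : R) (xs xd : R * R).
Hypotheses (s1_gt0 : 0 < s1) (PhiP : point_process Phi).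

Let f := relay_cost s1 s2 xs xd.

Let bounded_f x : bounded_set [set X | f X <= x].
Proof.
suff H X : f X <= x -> `|X| <= `|xs| + x / s1.
  exists (`|xs| + x / s1); split; first exact: num_real.
  by move=> M /ltW xM X /H /le_trans; apply.
rewrite /f /relay_cost ge_max => /andP[+ _].
rewrite mulrC -ler_pdivlMr// => Hx.
have abs_le (a b c : R) : `|a - b| <= Num.sqrt ((a - b) ^+ 2 + c ^+ 2).
  by rewrite -sqrtr_sqr ler_sqrt ?addr_ge0 ?sqr_ge0// lerDl sqr_ge0.
have nX : `|X| <= `|xs| + `|xs - X|.
  by rewrite -{1}(subKr xs X) (le_trans (ler_normB _ _)).
apply: (le_trans nX); rewrite lerD2l (le_trans _ Hx)// /eucl_dist.
rewrite [leLHS]prod_normE/= ge_max abs_le/= [leRHS](_ : _ = Num.sqrt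
  ((xs.2 - X.2) ^+ 2 + (xs.1 - X.1) ^+ 2)); last by rewrite addrC.
exact: abs_le.
Qed.

Let measurable_f :
  measurable_fun setT f.
Proof.
have msqrt (g : R * R -> R) : measurable_fun setT g ->
    measurable_fun setT (fun X => Num.sqrt (g X)).
  by apply: measurableT_comp; apply: continuous_measurable_fun; exact: sqrt_continuous.
apply: measurable_maxr; apply: measurable_funM => //; apply: msqrt;
  apply: measurable_funD; apply: measurable_funX; exact: measurable_funB.
Qed.

Lemma Gamma_opt_diff_attained w : Phi w !=set0 ->
  exists2 X, Phi w X &
    Gamma_opt_diff s1 s2 xs xd Phi w = (relay_cost s1 s2 xs xd X)%:E /\
    forall Y, Phi w Y -> relay_cost s1 s2 xs xd X <= relay_cost s1 s2 xs xd Y.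
Proof.
move=> [Z PZ]; have [fin _] := PhiP.
have /finite_fsetP[A AE] := fin w _ (bounded_f (f Z)).
have ZA : Z \in A by suff: [set` A] Z by []; rewrite -AE; split => /=.
case: (arg_minP (fun i : A => f (val i)) (erefl : xpredT [` ZA]%fset)) => X _ Xmin.
have : [set` A] (val X) by exact: valP.
rewrite -AE => -[/= PX fX].
have XY Y : Phi w Y -> f (val X) <= f Y.
  move=> PY; have [YZ|/ltW ZY] := leP (f Y) (f Z); last exact: le_trans fX ZY.
  have YA : Y \in A by suff: [set` A] Y by []; rewrite -AE; split.
  exact: (Xmin [` YA]%fset).
exists (val X) => //; split => //; apply/eqP; rewrite eq_le; apply/andP; split.
  by apply: ereal_inf_lbound; exists (val X).
by apply: le_ereal_inf_tmp => _ [Y PY <-]; rewrite lee_fin; exact: XY.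
Qed.

Lemma measurable_Gamma_opt_diff :
  measurable_fun setT (Gamma_opt_diff s1 s2 xs xd Phi).
Proof.
apply: (measurability _ (ErealGenCInfty.measurableE R)) => _ [_ [x ->] <-].
rewrite setTI.
pose B := [set X | f X < x].
have BB : bounded_borel B.
  split.
    have := @measurable_f measurableT `]-oo, x[%classic (measurable_itv _).
    by rewrite setTI set_itvE.
  have [M [Mr HM]] := bounded_f x.
  by exists M; split => // y My X /= /ltW fX; exact: HM.
have [fin mes] := PhiP.
have m0 := mes _ BB measurableT [set 0%E] (emeasurable_set1 _).
rewrite setTI in m0; congr measurable: m0; apply/seteqP; split => w /=.
  rewrite /npoints /counting asboolT; last by apply: fin; case: BB.
  move=> [/eqP]; rewrite pnatr_eq0 cardfs_eq0 => /eqP c0.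
  rewrite in_itv/= andbT; apply: le_ereal_inf_tmp => _ [Y PY <-].
  rewrite lee_fin leNgt; apply/negP => Yx.
  have : Y \in fset_set (Phi w `&` B).
    rewrite in_fset_set; last by apply: fin; case: BB.
    exact: mem_set.
  by rewrite c0.
rewrite in_itv/= andbT => xG; rewrite /npoints (_ : _ `&` _ = set0).
  by rewrite /counting asboolT ?fset_set0.
rewrite -subset0 => Y [PY /= Yx].
have : (Gamma_opt_diff s1 s2 xs xd Phi w <= (f Y)%:E)%E.
  by apply: ereal_inf_lbound; exists Y.
by move=> /(le_trans xG); rewrite lee_fin leNgt Yx.
Qed.

End Gamma_opt_diff_theory.

(* Main.v *)
(* The event Gamma <= gamma says that Phi meets the lens cut out by the discs of
   radii r1 around xs and r2 around xd; its complement has probability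
   exp (- lambda * area). The radical axis of the two circles cuts the lens into
   two circular segments, whose chords lie at signed distances h1 and h2 from
   the centers, with h1 + h2 = 2 d and r1^2 - h1^2 = r2^2 - h2^2. A segment of
   radius r at distance h has area r^2 acos (h / r) - h sqrt (r^2 - h^2), by
   Fubini and the substitution x = r cos t once it is rotated into standard
   position. Rotations preserve the product Lebesgue measure because they are
   products of shears, which translate each section. *)
Require Import Defs.
From mathcomp Require Import all_boot all_order all_algebra.
From mathcomp Require Import all_classical all_reals all_analysis.
From mathcomp Require Import measurable_realfun.
From mathcomp Require Import ring lra.
Set Implicit Arguments.
Unset Strict Implicit.
Unset Printing Implicit Defensive.
Import Order.TTheory GRing.Theory Num.Theory.
Import numFieldNormedType.Exports.
Local Open Scope classical_set_scope.
Local Open Scope ring_scope.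

Lemma lebesgue_measure_translation (R : realType) (c : R) (A : set R) :
  measurable A ->
  lebesgue_measure [set y | A (y + c)] = lebesgue_measure A.
Proof.
move=> mA.
have mt : measurable_fun setT
    (fun y : measurableTypeR R => y + c : measurableTypeR R).
  exact: measurable_funD.
transitivity (pushforward lebesgue_measure
  ((fun y => y + c) : _ -> measurableTypeR R) A) => //.
apply/esym/lebesgue_measure_unique => //= _ [[a b] _ <-].
rewrite /pushforward/=.
rewrite (_ : _ @^-1` _ = `]a - c, b - c]%classic); last first.
  by apply/seteqP; split => y /=; rewrite !in_itv/= ltrBlDr lerBrDr.
rewrite !lebesgue_measure_itv/= !lte_fin ltrD2r.
by case: ifP => // _; rewrite -!EFinD; congr (_%:E); lra.
Qed.

Lemma lebesgue2_ysection (R : realType) (A : set (R * R)) : measurable A ->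
  lebesgue2 A =
  (\int[@lebesgue_measure R]_y (@lebesgue_measure R) (ysection A y))%E.
Proof.
move=> mA.
have := @product_measure_unique _ _ _ _ R (@lebesgue_measure R)
  (@lebesgue_measure R)
  (product_measure2 (@lebesgue_measure R) (@lebesgue_measure R)).
by apply => // B C mB mC; rewrite /= product_measure2E.
Qed.

Lemma measurable_shear_snd (R : realType) (f : R -> R) (A : set (R * R)) :
  measurable_fun setT f -> measurable A ->
  measurable [set p : R * R | A (p.1, p.2 + f p.1)].
Proof.
move=> mf mA; rewrite -[X in measurable X]setTI.
apply: (_ : measurable_fun setT _) => //.
apply: measurable_fun_pair => //; apply: measurable_funD => //.
exact: measurableT_comp.
Qed.

Lemma measurable_shear_fst (R : realType) (f : R -> R) (A : set (R * R)) :
  measurable_fun setT f -> measurable A ->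
  measurable [set p : R * R | A (p.1 + f p.2, p.2)].
Proof.
move=> mf mA; rewrite -[X in measurable X]setTI.
apply: (_ : measurable_fun setT _) => //.
apply: measurable_fun_pair => //; apply: measurable_funD => //.
exact: measurableT_comp.
Qed.

Lemma lebesgue2_shear_snd (R : realType) (f : R -> R) (A : set (R * R)) :
  measurable_fun setT f -> measurable A ->
  lebesgue2 [set p | A (p.1, p.2 + f p.1)] = lebesgue2 A.
Proof.
move=> mf mA; rewrite /lebesgue2 /product_measure1.
apply: eq_integral => x _ /=.
rewrite -(@lebesgue_measure_translation _ (f x) (xsection A x));
  last exact: measurable_xsection.
by congr lebesgue_measure; apply/seteqP; split => y; rewrite /xsection/= !inE.
Qed.

Lemma lebesgue2_shear_fst (R : realType) (f : R -> R) (A : set (R * R)) :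
  measurable_fun setT f -> measurable A ->
  lebesgue2 [set p | A (p.1 + f p.2, p.2)] = lebesgue2 A.
Proof.
move=> mf mA; rewrite !lebesgue2_ysection//;
  last exact: (measurable_shear_fst mf mA).
apply: eq_integral => y _ /=.
rewrite -(@lebesgue_measure_translation _ (f y) (ysection A y));
  last exact: measurable_ysection.
by congr lebesgue_measure; apply/seteqP; split => x; rewrite /ysection/= !inE.
Qed.

Definition rotate (R : realType) (c s : R) (p : R * R) : R * R :=
  (c * p.1 + s * p.2, - s * p.1 + c * p.2).

Lemma measurable_rotate (R : realType) (c s : R) (A : set (R * R)) :
  measurable A -> measurable [set p | A (rotate c s p)].
Proof.
move=> mA; rewrite -[X in measurable X]setTI.
apply: (_ : measurable_fun setT _) => //.
by apply: measurable_fun_pair; apply: measurable_funD; apply: measurable_funM.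
Qed.

(* For s != 0 the rotation is a product of three shears; the half-turn, where
   s = 0, is the square of the quarter-turn. *)
Lemma lebesgue2_rotate (R : realType) (c s : R) (A : set (R * R)) :
  c ^+ 2 + s ^+ 2 = 1 -> measurable A ->
  lebesgue2 [set p | A (rotate c s p)] = lebesgue2 A.
Proof.
move=> cs mA.
have main (c' s' : R) (B : set (R * R)) : c' ^+ 2 + s' ^+ 2 = 1 -> s' != 0 ->
    measurable B -> lebesgue2 [set p | B (rotate c' s' p)] = lebesgue2 B.
  move=> cs' s0 mB; pose t := (1 - c') / s'.
  have mt : measurable_fun setT (fun y : R => t * y) by exact: measurable_funM.
  have ms : measurable_fun setT (fun y : R => - s' * y).
    exact: measurable_funM.
  rewrite -(lebesgue2_shear_fst mt mB).
  rewrite -(lebesgue2_shear_snd ms (measurable_shear_fst mt mB)).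
  rewrite -(lebesgue2_shear_fst mt
    (measurable_shear_snd ms (measurable_shear_fst mt mB))).
  congr lebesgue2; apply/seteqP; suff E p : rotate c' s' p =
      (p.1 + t * p.2 + t * (p.2 + - s' * (p.1 + t * p.2)),
       p.2 + - s' * (p.1 + t * p.2)) by split => p /=; rewrite E.
  have Et : t * s' = 1 - c' by rewrite /t divfK.
  have Et2 : s' = t * (1 + c').
    by apply: (mulIf s0); rewrite mulrAC Et; rewrite -expr2; lra.
  rewrite /rotate; congr pair.
  - transitivity (p.1 + 2 * t * p.2 - t * s' * (p.1 + t * p.2)); last by ring.
    by rewrite Et {1}Et2; ring.
  - by transitivity (p.2 - s' * p.1 - t * s' * p.2); [rewrite Et|]; ring.
have [s0|s0] := eqVneq s 0; last exact: main.
have /orP[/eqP ->|/eqP ->] : (c == 1) || (c == -1).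
  by rewrite -eqf_sqr expr1n; apply/eqP; rewrite -cs s0 expr0n addr0.
- congr lebesgue2; apply/seteqP; rewrite s0.
  by split => -[x y]; rewrite /rotate/= !mul1r oppr0 !mul0r addr0 add0r.
- have q : 0 ^+ 2 + 1 ^+ 2 = 1 :> R by rewrite expr1n expr0n add0r.
  rewrite -[RHS](main 0 1)// ?oner_neq0//.
  rewrite -[RHS](main 0 1)// ?oner_neq0//; last first.
    exact: measurable_rotate.
  congr lebesgue2; apply/seteqP; rewrite s0.
  split => -[x y]; rewrite /rotate/= !(mul1r, mul0r, mulN1r, oppr0, add0r, addr0);
    by rewrite ?opprK.
Qed.

Lemma lebesgue2_rigid (R : realType) (c s : R) (q : R * R) (A : set (R * R)) :
  c ^+ 2 + s ^+ 2 = 1 -> measurable A ->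
  lebesgue2 [set p | A (rotate c s (p.1 - q.1, p.2 - q.2))] = lebesgue2 A.
Proof.
move=> cs mA; rewrite -(lebesgue2_rotate cs mA).
have mr := measurable_rotate c s mA.
rewrite -(lebesgue2_shear_fst (f := cst (- q.1)) _ mr)//.
have mr' := @measurable_shear_fst _ (cst (- q.1)) _ (measurable_cst _) mr.
by rewrite -(lebesgue2_shear_snd (f := cst (- q.2)) _ mr').
Qed.

Lemma measurable_rigid (R : realType) (c s : R) (q : R * R) (A : set (R * R)) :
  measurable A ->
  measurable [set p | A (rotate c s (p.1 - q.1, p.2 - q.2))].
Proof.
move=> mA; have mr := measurable_rotate c s mA.
apply: (@measurable_shear_snd _ (cst (- q.2))
  [set p | A (rotate c s (p.1 - q.1, p.2))]) => //.
exact: (@measurable_shear_fst _ (cst (- q.1)) _ (measurable_cst _) mr).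
Qed.

Lemma lebesgue_measure_sqr_le (R : realType) (m : R) :
  lebesgue_measure [set y : R | y ^+ 2 <= m] = (2 * Num.sqrt m)%:E.
Proof.
have [m0|m0] := ltP m 0.
  rewrite ltr0_sqrtr// mulr0 (_ : [set y | _] = set0) ?measure0//.
  by rewrite -subset0 => y /= /le_lt_trans/(_ m0); rewrite ltNge sqr_ge0.
rewrite (_ : [set y | _] = `[- Num.sqrt m, Num.sqrt m]%classic); last first.
  apply/seteqP; split => y /=; rewrite in_itv/= -ler_norml -sqrtr_sqr ler_sqrt//.
rewrite lebesgue_measure_itv/= lte_fin.
case: ltP => [_|]; first by rewrite -EFinD; congr (_%:E); ring.
by have := sqrtr_ge0 m => ? ?; congr (_%:E); lra.
Qed.

Lemma integral_half_chord (R : realType) (r t : R) : 0 < r -> 0 <= t <= pi ->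
  (\int[@lebesgue_measure R]_(x in `[(r * cos t)%R, r])
     (2 * Num.sqrt (r ^+ 2 - x ^+ 2))%:E =
   (r ^+ 2 * (t - sin t * cos t))%:E)%E.
Proof.
move=> r0 /andP[]; rewrite le_eqVlt => /predU1P[<- _|t0 tpi].
  by rewrite cos0 sin0 mulr1 set_itv1 integral_set1 mul0r subrr mulr0.
pose F x : R := r * cos x.
have dF (x : R) : is_derive x 1 F (- (r * sin x)).
  by apply: is_derive_eq; rewrite /GRing.scale/=; ring.
have F'E : (derive1 F) = (fun x => - (r * sin x)).
  by apply/funext => x; rewrite derive1E derive_val.
have cF' : continuous (derive1 F).
  rewrite F'E => x; apply: cvgN; apply: cvgM; first exact: cvg_cst.
  exact: continuous_sin.
have cF (x : R) : {for x, continuous F}.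
  by apply: differentiable_continuous; apply/derivable1_diffP; exact: ex_derive.
have -> : `[r * cos t, r]%classic = `[F t, F 0]%classic.
  by rewrite /F cos0 mulr1.
rewrite integration_by_substitution_decreasing//; last 6 first.
- exact: ltW.
- move=> x y; rewrite !in_itv/= => /andP[x0 xt] /andP[z0 zt] yx.
  rewrite /F ltr_pM2l// ltr_cos// in_itv/=; apply/andP; split => //;
    exact: le_trans tpi.
- by apply/cvg_ex; eexists; apply: cvg_at_right_filter; exact: cF'.
- by apply/cvg_ex; eexists; apply: cvg_at_left_filter; exact: cF'.
- split.
  + by move=> x _; exact: ex_derive.
  + by apply: cvg_at_right_filter; exact: cF.
  + by apply: cvg_at_left_filter; exact: cF.
- apply: continuous_subspaceT => x; apply: cvgM; first exact: cvg_cst.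
  apply: continuous_comp; last exact: sqrt_continuous.
  by apply: cvgB; [exact: cvg_cst|exact: exprn_continuous].
pose G x : R := r ^+ 2 * (x - sin x * cos x).
have dG (x : R) : is_derive x 1 G (2 * (r * sin x) ^+ 2).
  apply: is_derive_eq; rewrite /GRing.scale/=.
  have := cos2Dsin2 x => H; transitivity (r ^+ 2 * (1 - cos x ^+ 2 + sin x ^+ 2)).
    by ring.
  by rewrite -{1}H; ring.
have cG (x : R) : {for x, continuous G}.
  by apply: differentiable_continuous; apply/derivable1_diffP; exact: ex_derive.
transitivity (\int[@lebesgue_measure R]_(x in `[0%R, t])
    (2 * (r * sin x) ^+ 2)%:E)%E.
  apply: eq_integral => x; rewrite inE/= in_itv/= => /andP[x0 xt]; congr (_%:E).
  rewrite F'E /= opprK /F.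
  rewrite [LHS](_ : _ = 2 * Num.sqrt (r ^+ 2 - (r * cos x) ^+ 2) * (r * sin x))//.
  have sx : 0 <= r * sin x.
    by apply: mulr_ge0; [exact: ltW|rewrite sin_ge0_pi// x0 (le_trans xt)].
  have -> : r ^+ 2 - (r * cos x) ^+ 2 = (r * sin x) ^+ 2.
    by rewrite !exprMn sin2cos2; ring.
  by rewrite sqrtr_sqr ger0_norm//; ring.
rewrite (@continuous_FTC2 _ _ G)//.
- by rewrite /G sin0 mul0r subrr mulr0 sube0.
- apply: continuous_subspaceT => x; apply: cvgM; first exact: cvg_cst.
  apply: (@cvg_comp _ _ _ (fun x => r * sin x) (fun x => x ^+ 2));
    last exact: exprn_continuous.
  by apply: cvgM; [exact: cvg_cst|exact: continuous_sin].
- split.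
  + by move=> x _; exact: ex_derive.
  + by apply: cvg_at_right_filter; exact: cG.
  + by apply: cvg_at_left_filter; exact: cG.
- by move=> x _; rewrite derive1E derive_val.
Qed.

(* The boundary chord is included iff b = true. *)
Definition circular_segment (R : realType) (b : bool) (r h : R) :
    set (R * R) :=
  [set p | p.1 \in Interval (BSide b h) +oo%O /\ p.1 ^+ 2 + p.2 ^+ 2 <= r ^+ 2].

Lemma measurable_circular_segment (R : realType) (b : bool) (r h : R) :
  measurable (circular_segment b r h).
Proof.
have mfst : measurable_fun setT (fst : R * R -> R) by exact: measurable_fst.
have msnd : measurable_fun setT (snd : R * R -> R) by exact: measurable_snd.
have mf : measurable_fun setT (fun p : R * R => p.1 ^+ 2 + p.2 ^+ 2 : R).
  by apply: measurable_funD; exact: measurable_funX.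
have m1 := mfst measurableT _ (measurable_itv (Interval (BSide b h) +oo%O)).
have m2 := mf measurableT _ (measurable_itv `]-oo, (r ^+ 2)]).
by have := measurableI _ _ m1 m2; rewrite !setTI; congr measurable.
Qed.

Definition clamp1 (R : realType) (x : R) : R := Num.max (-1) (Num.min 1 x).

Lemma clamp1_itv (R : realType) (x : R) : -1 <= clamp1 x <= 1.
Proof.
by rewrite /clamp1 le_max lexx/= ge_max ge_min lexx/= andbT; lra.
Qed.

(* For `|h| > r the segment is empty or the whole disc; this is what the clamp
   and the square root, which is 0 at negative numbers, then account for. *)
Lemma lebesgue2_circular_segment (R : realType) (b : bool) (r h : R) : 0 < r ->
  lebesgue2 (circular_segment b r h) =
  (r ^+ 2 * acos (clamp1 (h / r)) - h * Num.sqrt (r ^+ 2 - h ^+ 2))%:E.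
Proof.
move=> r0; pose f x := 2 * Num.sqrt (r ^+ 2 - x ^+ 2).
pose k := clamp1 (h / r).
have mf : measurable_fun setT (fun x : R => (f x)%:E).
  apply/measurable_EFinP; apply: continuous_measurable_fun => x.
  apply: cvgM; first exact: cvg_cst.
  apply: continuous_comp; last exact: sqrt_continuous.
  by apply: cvgB; [exact: cvg_cst|exact: exprn_continuous].
have f0 x : f x != 0 -> - r < x < r.
  apply: contra_neqT; rewrite -ltr_norml -leNgt => rx.
  rewrite /f ler0_sqrtr ?mulr0// subr_le0 -[leRHS]real_normK ?num_real//.
  by rewrite ler_sqr ?nnegrE// ltW.
rewrite /lebesgue2 /product_measure1.
transitivity (\int[@lebesgue_measure R]_(x in
    [set` Interval (BSide b h) +oo%O]) (f x)%:E)%E.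
  rewrite [RHS]integral_mkcond; apply: eq_integral => x _; rewrite patchE /=.
  case: ifPn => [|/negP xh].
    rewrite inE/= => xh; rewrite -lebesgue_measure_sqr_le.
    by congr lebesgue_measure; apply/seteqP; split => y;
      rewrite /xsection/= inE /circular_segment/= lerBrDl ?xh => // -[].
  rewrite (_ : xsection _ _ = set0) ?measure0// -subset0 => y.
  by rewrite /xsection/= inE => -[/= xh' _]; apply: xh; rewrite inE.
have kE x : - r < x < r -> (x \in Interval (BSide b h) +oo%O) =
    (x \in Interval (BSide b (r * k)) (BRight r)).
  move=> /andP[rx xr]; have xr1 : -1 < x / r < 1.
    by rewrite ltr_pdivlMr// ltr_pdivrMr// mulN1r mul1r rx.
  have /andP[x1 x2] := xr1.
  rewrite !in_itv/= (ltW xr) !andbT.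
  case: b => /=; rewrite /k /clamp1.
    rewrite mulrC -ler_pdivlMr// ge_max (ltW x1)/= ge_min leNgt x2/=.
    by rewrite ler_pM2r// invr_gt0.
  rewrite mulrC -ltr_pdivlMr// gt_max x1/= gt_min ltNge (ltW x2)/=.
  by rewrite ltr_pM2r// invr_gt0.
transitivity (\int[@lebesgue_measure R]_(x in
    [set` Interval (BSide b (r * k)%R) (BRight r)]) (f x)%:E)%E.
  rewrite [LHS]integral_mkcond [RHS]integral_mkcond; apply: eq_integral => x _.
  rewrite !patchE; have [fx0|/f0/kE xr] := eqVneq (f x) 0.
    by rewrite fx0; do 2 case: ifP.
  by rewrite !mem_setE xr.
transitivity (\int[@lebesgue_measure R]_(x in `[(r * k)%R, r]) (f x)%:E)%E.
  case: (b) => //; apply: integral_itv_obnd_cbnd.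
  exact: measurable_funS mf.
have /andP[k1 k2] := clamp1_itv (h / r).
have kI : -1 <= k <= 1 by apply/andP.
have cosk : cos (acos k) = k by rewrite acosK// in_itv.
rewrite -{1}cosk integral_half_chord ?acos_ge0 ?acos_lepi//.
congr (_%:E); rewrite mulrBr; congr (_ - _).
rewrite cosk sin_acos//.
have -> : r ^+ 2 * (Num.sqrt (1 - k ^+ 2) * k) =
   r * k * Num.sqrt (r ^+ 2 - (r * k) ^+ 2).
  have -> : r ^+ 2 - (r * k) ^+ 2 = r ^+ 2 * (1 - k ^+ 2) by ring.
  by rewrite sqrtrM ?sqr_ge0// sqrtr_sqr gtr0_norm//; ring.
have [hr|hr] := leP `|h| r.
  have -> // : r * k = h.
  move: hr; rewrite ler_norml => /andP[h1 h2].
  rewrite /k /clamp1 min_r ?max_r ?ler_pdivlMr ?ler_pdivrMr ?mul1r ?mulN1r//.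
  by rewrite mulrC divfK// gt_eqF.
have k2E : k ^+ 2 = 1.
  rewrite /k /clamp1; move: hr; rewrite ltNge ler_norml negb_and -!ltNge.
  move=> /orP[hr|hr].
    rewrite max_l ?sqrrN ?expr1n// ge_min; apply/orP; right.
    by rewrite ler_pdivrMr// mulN1r ltW.
  by rewrite min_l ?max_r ?expr1n// ler_pdivlMr// mul1r ltW.
rewrite exprMn k2E mulr1 subrr sqrtr0 ler0_sqrtr ?mulr0// subr_le0.
by rewrite -[leRHS]real_normK ?num_real// ler_sqr ?nnegrE// ltW.
Qed.

Lemma eucl_dist_le (R : realType) (p q : R * R) (r : R) : 0 <= r ->
  (eucl_dist p q <= r) = ((p.1 - q.1) ^+ 2 + (p.2 - q.2) ^+ 2 <= r ^+ 2).
Proof.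
move=> r0; rewrite /eucl_dist -ler_sqr ?nnegrE ?sqrtr_ge0// sqr_sqrtr//.
by rewrite addr_ge0 ?sqr_ge0.
Qed.

Lemma eucl_dist_ge0 (R : realType) (p q : R * R) : 0 <= eucl_dist p q.
Proof. exact: sqrtr_ge0. Qed.

Lemma eucl_dist_triangle (R : realType) (p q m : R * R) :
  eucl_dist p q <= eucl_dist p m + eucl_dist m q.
Proof.
have sq (u v : R * R) : eucl_dist u v ^+ 2 = (u.1 - v.1) ^+ 2 + (u.2 - v.2) ^+ 2.
  by rewrite sqr_sqrtr// addr_ge0 ?sqr_ge0.
rewrite eucl_dist_le ?addr_ge0 ?eucl_dist_ge0//.
set a := p.1 - m.1; set b := p.2 - m.2; set c := m.1 - q.1; set e := m.2 - q.2.
have -> : p.1 - q.1 = a + c by rewrite /a /c; ring.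
have -> : p.2 - q.2 = b + e by rewrite /b /e; ring.
suff CS : a * c + b * e <= eucl_dist p m * eucl_dist m q.
  by rewrite [leRHS]sqrrD !sq -/a -/b -/c -/e mulr2n; lra.
apply: (le_trans (ler_norm _)); rewrite -ler_sqr ?nnegrE ?mulr_ge0 ?eucl_dist_ge0//.
rewrite exprMn !sq real_normK ?num_real// -/a -/b -/c -/e -subr_ge0.
have -> : (a ^+ 2 + b ^+ 2) * (c ^+ 2 + e ^+ 2) - (a * c + b * e) ^+ 2 =
  (a * e - b * c) ^+ 2 by ring.
exact: sqr_ge0.
Qed.

Definition lens (R : realType) (xs xd : R * R) (r1 r2 : R) : set (R * R) :=
  [set p | eucl_dist xs p <= r1 /\ eucl_dist p xd <= r2].

Lemma bounded_lens (R : realType) (xs xd : R * R) (r1 r2 : R) :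
  bounded_set (lens xs xd r1 r2).
Proof.
exists (`|xs.1| + `|xs.2| + r1); split; first exact: num_real.
move=> M /ltW rM p [pr _]; apply: (le_trans _ rM).
have r0 : 0 <= r1 := le_trans (eucl_dist_ge0 _ _) pr.
move: pr; rewrite eucl_dist_le// => pr.
have bnd (a b : R) : (a - b) ^+ 2 <= r1 ^+ 2 -> `|b| <= `|a| + r1.
  rewrite -[leLHS]real_normK ?num_real// ler_sqr ?nnegrE// => ab.
  by rewrite -[b](subKr a); apply: (le_trans (ler_normB _ _)); rewrite lerD2l.
have b1 : `|p.1| <= `|xs.1| + r1.
  by apply: bnd; apply: le_trans pr; rewrite lerDl sqr_ge0.
have b2 : `|p.2| <= `|xs.2| + r1.
  by apply: bnd; apply: le_trans pr; rewrite lerDr sqr_ge0.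
rewrite [leLHS]prod_normE ge_max; apply/andP; split.
  by apply: (le_trans b1); rewrite lerD2r lerDl.
by apply: (le_trans b2); rewrite lerD2r lerDr.
Qed.

(* The common chord is attributed to the segment centered at xs. *)
Lemma lens_split (R : realType) (xs xd : R * R) (d r1 r2 : R) :
  0 < d -> eucl_dist xs xd = 2 * d -> 0 <= r1 -> 0 <= r2 ->
  let c := (xd.1 - xs.1) / (2 * d) in
  let s := (xd.2 - xs.2) / (2 * d) in
  let A1 := [set p : R * R | circular_segment true r1
    ((r1 ^+ 2 - r2 ^+ 2 + 4 * d ^+ 2) / (4 * d))
    (rotate c s (p.1 - xs.1, p.2 - xs.2))] in
  let A2 := [set p : R * R | circular_segment false r2
    ((r2 ^+ 2 - r1 ^+ 2 + 4 * d ^+ 2) / (4 * d))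
    (rotate (- c) (- s) (p.1 - xd.1, p.2 - xd.2))] in
  [/\ c ^+ 2 + s ^+ 2 = 1, lens xs xd r1 r2 = A1 `|` A2 & A1 `&` A2 = set0].
Proof.
move=> d0 xsd r10 r20 c s A1 A2.
have sd : (xd.1 - xs.1) ^+ 2 + (xd.2 - xs.2) ^+ 2 = (2 * d) ^+ 2.
  rewrite -xsd sqr_sqrtr ?addr_ge0 ?sqr_ge0//.
  by rewrite -[xs.1 - _]opprB -[xs.2 - _]opprB !sqrrN.
have dn0 : d != 0 by rewrite gt_eqF.
have cs : c ^+ 2 + s ^+ 2 = 1.
  by rewrite /c /s !expr_div_n -mulrDl sd divff// expf_neq0// mulf_neq0.
have xd1 : xd.1 = xs.1 + 2 * d * c by rewrite /c; field.
have xd2 : xd.2 = xs.2 + 2 * d * s by rewrite /s; field.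
pose u (p : R * R) := c * (p.1 - xs.1) + s * (p.2 - xs.2).
pose w (p : R * R) := - s * (p.1 - xs.1) + c * (p.2 - xs.2).
have Es p : (xs.1 - p.1) ^+ 2 + (xs.2 - p.2) ^+ 2 = u p ^+ 2 + w p ^+ 2.
  transitivity ((c ^+ 2 + s ^+ 2) * ((xs.1 - p.1) ^+ 2 + (xs.2 - p.2) ^+ 2)).
    by rewrite cs mul1r.
  by rewrite /u /w; ring.
have Ev p : - c * (p.1 - xd.1) + - s * (p.2 - xd.2) = 2 * d - u p.
  transitivity (2 * d * (c ^+ 2 + s ^+ 2) - u p); last by rewrite cs mulr1.
  by rewrite xd1 xd2 /u; ring.
have Ew p : - - s * (p.1 - xd.1) + - c * (p.2 - xd.2) = - w p.
  by rewrite xd1 xd2 /w; ring.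
have Ed p : (p.1 - xd.1) ^+ 2 + (p.2 - xd.2) ^+ 2 = (2 * d - u p) ^+ 2 + w p ^+ 2.
  transitivity ((c ^+ 2 + s ^+ 2) * ((p.1 - xd.1) ^+ 2 + (p.2 - xd.2) ^+ 2)).
    by rewrite cs mul1r.
  by rewrite -Ev -[w p]opprK -Ew; ring.
have A1E p : A1 p <-> (r1 ^+ 2 - r2 ^+ 2 + 4 * d ^+ 2 <= u p * (4 * d) /\
    u p ^+ 2 + w p ^+ 2 <= r1 ^+ 2).
  by rewrite /A1 /circular_segment/= in_itv/= andbT ler_pdivrMr// mulr_gt0.
have A2E p : A2 p <-> (u p * (4 * d) < r1 ^+ 2 - r2 ^+ 2 + 4 * d ^+ 2 /\
    (2 * d - u p) ^+ 2 + w p ^+ 2 <= r2 ^+ 2).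
  rewrite /A2 /circular_segment/= in_itv/= andbT Ev Ew sqrrN.
  rewrite ltr_pdivrMr ?mulr_gt0//.
  by split => -[H1 H2]; split => //; lra.
split => //.
- apply/seteqP; split => p.
    rewrite /lens/= !eucl_dist_le// Es Ed => -[H1 H2].
    have [ph|ph] := leP (r1 ^+ 2 - r2 ^+ 2 + 4 * d ^+ 2) (u p * (4 * d)).
      by left; apply/A1E.
    by right; apply/A2E.
  rewrite /lens/= !eucl_dist_le// Es Ed.
  by move=> [/A1E[H1 H2]|/A2E[H1 H2]]; split => //; lra.
- rewrite -subset0 => p [/A1E[H1 _] /A2E[H2 _]].
  by move: H1; rewrite leNgt H2.
Qed.

Lemma measurable_lens (R : realType) (xs xd : R * R) (d r1 r2 : R) :
  0 < d -> eucl_dist xs xd = 2 * d -> 0 <= r1 -> 0 <= r2 ->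
  measurable (lens xs xd r1 r2).
Proof.
move=> d0 xsd r10 r20; have [_ -> _] := lens_split d0 xsd r10 r20.
by apply: measurableU; apply: measurable_rigid; exact: measurable_circular_segment.
Qed.

Lemma lebesgue2U (R : realType) (A B : set (R * R)) :
  measurable A -> measurable B -> A `&` B = set0 ->
  lebesgue2 (A `|` B) = (lebesgue2 A + lebesgue2 B)%E.
Proof. by move=> mA mB AB; rewrite /lebesgue2 measureU. Qed.

Lemma lebesgue2_lens (R : realType) (xs xd : R * R) (d r1 r2 : R) :
  0 < d -> eucl_dist xs xd = 2 * d -> 0 < r1 -> 0 < r2 ->
  lebesgue2 (lens xs xd r1 r2) =
  (r1 ^+ 2 * asec (4 * d * r1 / (r1 ^+ 2 - r2 ^+ 2 + 4 * d ^+ 2))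
   + r2 ^+ 2 * asec (4 * d * r2 / (r2 ^+ 2 - r1 ^+ 2 + 4 * d ^+ 2))
   - 2^-1 * Num.sqrt ((r1 + r2 - 2 * d) * (r1 - r2 + 2 * d)
                      * (- r1 + r2 + 2 * d) * (r1 + r2 + 2 * d)))%:E.
Proof.
move=> d0 xsd r10 r20.
have [] := lens_split d0 xsd (ltW r10) (ltW r20).
set c := _ / _; set s := (xd.2 - _) / _.
set h1 := _ / (4 * d); set h2 := (r2 ^+ 2 - _ + _) / (4 * d) => cs -> AB.
have dn0 : d != 0 by rewrite gt_eqF.
have cs' : (- c) ^+ 2 + (- s) ^+ 2 = 1 by rewrite !sqrrN.
have [mS1 mS2] :=
  (measurable_circular_segment true r1 h1, measurable_circular_segment false r2 h2).
rewrite lebesgue2U//; [|exact: measurable_rigid..].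
rewrite !lebesgue2_rigid//.
rewrite !lebesgue2_circular_segment// -EFinD; congr (_%:E).
have E1 : asec (4 * d * r1 / (r1 ^+ 2 - r2 ^+ 2 + 4 * d ^+ 2)) =
    acos (clamp1 (h1 / r1)).
  by rewrite /asec /clamp1 invf_div invfM mulrA.
have E2 : asec (4 * d * r2 / (r2 ^+ 2 - r1 ^+ 2 + 4 * d ^+ 2)) =
    acos (clamp1 (h2 / r2)).
  by rewrite /asec /clamp1 invf_div invfM mulrA.
rewrite E1 E2.
have -> : r2 ^+ 2 - h2 ^+ 2 = r1 ^+ 2 - h1 ^+ 2 by rewrite /h1 /h2; field.
have -> : (r1 + r2 - 2 * d) * (r1 - r2 + 2 * d)
    * (- r1 + r2 + 2 * d) * (r1 + r2 + 2 * d) =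
    (4 * d) ^+ 2 * (r1 ^+ 2 - h1 ^+ 2) by rewrite /h1; field.
rewrite sqrtrM ?sqr_ge0// sqrtr_sqr gtr0_norm ?mulr_gt0//.
have -> : h2 = 2 * d - h1 by rewrite /h1 /h2; field.
by field.
Qed.

Lemma relay_cost_le (R : realType) (s1 s2 : R) (xs xd X : R * R) (g : R) :
  0 < s1 -> 0 < s2 ->
  relay_cost s1 s2 xs xd X <= g <-> lens xs xd (g / s1) (g / s2) X.
Proof.
move=> s10 s20; rewrite /relay_cost ge_max /lens/= !ler_pdivlMr//.
by rewrite ![_ * s1]mulrC ![_ * s2]mulrC; split => /andP.
Qed.

Lemma npoints_eq0 (R : realType) T (Phi : T -> set (R * R)) (B : set (R * R)) w :
  finite_set (Phi w `&` B) ->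
  npoints Phi B w = 0%R%:E <-> Phi w `&` B = set0.
Proof.
move=> fin; rewrite /npoints /counting asboolT//; split => [|->].
  move=> [/eqP]; rewrite pnatr_eq0 finmap.cardfs_eq0 => /eqP E.
  by rewrite -(fset_setK fin) E set_fset0.
by rewrite fset_set0 finmap.cardfs0.
Qed.

Lemma Gamma_opt_diff_le (R : realType) (disp : measure_display)
    (T : measurableType disp) (Phi : T -> set (R * R)) (s1 s2 : R)
    (xs xd : R * R) (g : R) (w : T) :
  0 < s1 -> 0 < s2 -> point_process Phi ->
  (Gamma_opt_diff s1 s2 xs xd Phi w <= g%:E)%E <->
  Phi w `&` lens xs xd (g / s1) (g / s2) !=set0.
Proof.
move=> s10 s20 PhiP; split; last first.
  move=> [X [PX /relay_cost_le Xg]].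
  apply: (@le_trans _ _ (relay_cost s1 s2 xs xd X)%:E).
    by apply: ereal_inf_lbound; exists X.
  by rewrite lee_fin Xg.
have [P0|/set0P/(Gamma_opt_diff_attained s2 xs xd s10 PhiP)] := eqVneq (Phi w) set0.
  by rewrite /Gamma_opt_diff P0 image_set0 ereal_inf0 leNgt ltry.
move=> [X PX [-> _]]; rewrite lee_fin => Xg.
by exists X; split => //; exact/relay_cost_le.
Qed.

Theorem theorem9 (R : realType) (disp : measure_display)
    (T : measurableType disp) (P : probability T R)
    (lambda : R) (Phi : T -> set (R * R))
    (xs xd : R * R) (d s1 s2 : R)
    (hlambda : 0 < lambda) (hPhi : homogeneous_poisson P lambda Phi)
    (hd : 0 < d) (hx : eucl_dist xs xd = 2 * d) (hs1 : 0 < s1) (hs2 : 0 < s2)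
    (gamma : R) :
  let F := cdfe P (Gamma_opt_diff s1 s2 xs xd Phi) in
  let r1 := gamma / s1 in
  let r2 := gamma / s2 in
  (gamma < 2 * d * (s1 * s2 / (s1 + s2)) -> F gamma = 0%E) /\
  (2 * d * (s1 * s2 / (s1 + s2)) <= gamma ->
    F gamma =
      (1 - expR (
        - lambda * r1 ^+ 2
            * asec (4 * d * r1 / (r1 ^+ 2 - r2 ^+ 2 + 4 * d ^+ 2))
        - lambda * r2 ^+ 2
            * asec (4 * d * r2 / (r2 ^+ 2 - r1 ^+ 2 + 4 * d ^+ 2))
        + lambda / 2
            * Num.sqrt ((r1 + r2 - 2 * d) * (r1 - r2 + 2 * d)
                        * (- r1 + r2 + 2 * d) * (r1 + r2 + 2 * d))))%:E).
Proof.
move=> F r1 r2; have [PhiP pmf _] := hPhi.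
have FE : F gamma = P [set w | Phi w `&` lens xs xd r1 r2 !=set0].
  by rewrite /F /cdfe; congr (P _); apply/seteqP; split => w /=;
    move/(Gamma_opt_diff_le xs xd gamma w hs1 hs2 PhiP).
have thr (g : R) : g < 2 * d * (s1 * s2 / (s1 + s2)) <-> g / s1 + g / s2 < 2 * d.
  have -> : g / s1 + g / s2 = g / (s1 * s2 / (s1 + s2)).
    by field; rewrite !gt_eqF// addr_gt0.
  by rewrite ltr_pdivrMr// divr_gt0 ?mulr_gt0 ?addr_gt0.
split => [/thr small|gbig].
  rewrite FE (_ : [set w | _] = set0) ?measure0// -subset0 => w [X [_ [X1 X2]]].
  have := eucl_dist_triangle xs xd X; rewrite hx leNgt => /negP; apply.
  by apply: le_lt_trans small; exact: lerD.
have g0 : 0 < gamma.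
  apply: lt_le_trans gbig; apply: mulr_gt0; first exact: mulr_gt0.
  by rewrite divr_gt0 ?mulr_gt0 ?addr_gt0.
have r10 : 0 < r1 by exact: divr_gt0.
have r20 : 0 < r2 by exact: divr_gt0.
have BB : bounded_borel (lens xs xd r1 r2).
  split; last exact: bounded_lens.
  exact: measurable_lens hd hx (ltW r10) (ltW r20).
have [fin mes] := PhiP.
have -> : F gamma = P (~` [set w | npoints Phi (lens xs xd r1 r2) w = 0%R%:E]).
  rewrite FE; congr (P _); apply/seteqP; split => w /= H.
    by move/npoints_eq0 => /(_ (fin _ _ BB.2)) E; move/set0P/eqP: H; apply.
  apply/set0P/eqP => E; apply: H; apply/npoints_eq0 => //; exact: fin BB.2.
rewrite probability_setC; last first.
  have := mes _ BB measurableT [set 0%R%:E] (emeasurable_set1 _).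
  by rewrite setTI.
rewrite [P _](pmf _ 0%N BB) (lebesgue2_lens hd hx r10 r20)/=.
rewrite expr0 fact0 divr1 mul1r -EFinB.
by congr (1 - expR _)%:E; ring.
Qed.
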